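(* Let $K$ be a number field, let $S$ be a finite set of primes of $K$ containing all archimedean ones, and let $\mathcal O=\mathcal O_S$ be the ring of $S$-integers of $K$. Let $A\in\mathrm{SL}_2(\mathcal O)$ and suppose the group of units $\mathcal O^\times$ is infinite. 1) If the $\mathcal O$-points of $V_k(A)$ are Zariski dense for some $k\geq 4$, then the $\mathcal O$-points of $V_{k'}(A)$ are Zariski dense for all $k'\geq k$. 2) If $k\geq 4$ and $V_k(A)(\mathcal O)\neq\emptyset$, then the $\mathcal O$-points of $V_k(A)$ are Zariski dense.
   Context: The ring of $S$-integers is $\mathcal O_S=\{x\in K\mid v(x)\ge 0\text{ for all primes } v\notin S\}$. Put $U(x)=\begin{pmatrix} 1 & x \\ 0 & 1 \end{pmatrix}$, $L(x)=\begin{pmatrix} 1 & 0 \\ x & 1 \end{pmatrix}$. For $A\in\mathrm{SL}_2(\mathcal O)$ and $k\ge1$, $V_k(A)\subseteq\mathbb A^k_{/\mathcal O}$ is the affine variety with coordinates $x_1,\ldots,x_k$ defined by the entrywise equations of $A=L(x_1)U(x_2)L(x_3)U(x_4)\cdots$, an alternating product of $k$ factors beginning with $L(x_1)$, with last factor $L(x_k)$ if $k$ is odd and $U(x_k)$ if $k$ is even. Zariski density: the $\mathcal O$-points $V(\mathcal O)\subseteq\mathcal O^k$ of such a variety $V$ are Zariski dense if every polynomial in $K[x_1,\ldots,x_k]$ vanishing on $V(\mathcal O)$ vanishes on $V(\overline K)$. *)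

(* Defs.v *)
From HB Require Import structures.
From mathcomp Require Import all_boot all_order all_algebra all_field.
From mathcomp Require Import boolp classical_sets functions cardinality.
From mathcomp Require Import mpoly.

Set Implicit Arguments.
Unset Strict Implicit.
Unset Printing Implicit Defensive.

Import Order.TTheory GRing.Theory Num.Theory.

Local Open Scope ring_scope.

(* A non-archimedean prime of K is its normalized discrete valuation.  The
   value +oo at 0 is encoded as 0; fixing that value matters, since otherwise
   one prime would correspond to infinitely many records. *)
Record finite_prime (K : fieldExtType rat) := FinitePrime {
  ord_at :> K -> int;
  ord_at0 : ord_at 0 = 0;
  ord_atM : forall x y, x != 0 -> y != 0 ->
    ord_at (x * y) = ord_at x + ord_at y;
  ord_atD : forall x y, x != 0 -> y != 0 -> x + y != 0 ->
    Num.min (ord_at x) (ord_at y) <= ord_at (x + y);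
  ord_at_onto : forall n : int, exists2 x, x != 0 & ord_at x = n
}.

(* An archimedean prime of K is the absolute value |sigma(.)| of a complex
   embedding sigma, so that conjugate embeddings give the same prime.
   Embeddings of a number field take values in algC. *)
Record archimedean_prime (K : fieldExtType rat) := ArchimedeanPrime {
  abs_at :> K -> algC;
  abs_atP : exists sigma : {rmorphism K -> algC},
    forall x, abs_at x = `|sigma x|
}.

Inductive prime_of (K : fieldExtType rat) :=
| Finite_prime of finite_prime K
| Archimedean_prime of archimedean_prime K.

Definition S_integers (K : fieldExtType rat) (S : set (prime_of K)) : {pred K} :=
  fun x => `[< forall v : finite_prime K, ~ S (Finite_prime v) -> 0 <= v x >].

Definition units_of (K : fieldExtType rat) (O : {pred K}) : set K :=
  fun u => u \in O /\ exists2 w, w \in O & u * w = 1.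

Definition in_SL2 (K : fieldExtType rat) (O : {pred K}) (A : 'M[K]_2) : Prop :=
  A \is a mxOver O /\ \det A = 1.

Definition U_mx (R : comNzRingType) (x : R) : 'M[R]_2 :=
  \matrix_(i < 2, j < 2) (if i == j then 1 else if (i < j)%N then x else 0).

Definition L_mx (R : comNzRingType) (x : R) : 'M[R]_2 :=
  \matrix_(i < 2, j < 2) (if i == j then 1 else if (j < i)%N then x else 0).

(* The coordinates x_1, ..., x_k are x 0, ..., x (k - 1). *)
Definition V_points (R : comNzRingType) (k : nat) (A : 'M[R]_2) :
    set ('I_k -> R) :=
  fun x => A = \prod_(i < k) (if odd i then U_mx (x i) else L_mx (x i)).

Definition V_O_points (K : fieldExtType rat) (O : {pred K}) (k : nat)
    (A : 'M[K]_2) : set ('I_k -> K) :=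
  fun x => V_points A x /\ forall i, x i \in O.

Definition Zariski_dense_V (K : fieldExtType rat) (Kbar : closedFieldType)
    (iota : {rmorphism K -> Kbar}) (O : {pred K}) (k : nat) (A : 'M[K]_2) :
    Prop :=
  forall p : {mpoly K[k]},
    (forall x, V_O_points O A x -> p.@[x] = 0) ->
    forall y, V_points (map_mx iota A) y -> (map_mpoly iota p).@[y] = 0.

(* Main.v *)
(* The O-points of V_k(A) are O-valued sequences of length k with a prescribed
   alternating product.  Fibering V_(k+1)(A) by the first coordinate, one
   proceeds by induction on k.  If there is one O-point, infinitely many fibers
   have one: with a = 1 + x_2 x_3, the product of the first four factors is
   unchanged by
     (x_1, x_2, x_3, x_4) |->
       (x_1 - m x_3, x_2 / u, x_3 u, x_4 + m x_2 / u)   with u = 1 + a m,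
   and there are infinitely many units u = 1 mod a since O / aO is finite; when
   x_3 = 0, one can instead merge x_2 and x_4 and split x_1.  On the other side,
   almost every point of V_(k+1)(A) lies on a rational curve in V_(k+1)(A) along
   which the first coordinate is a parameter, so that the points of the curve
   over these infinitely many fibers, which are in the closure of the O-points
   by induction, determine a polynomial on the whole curve.  In V_3, which the
   induction starts from, points with x_2 <> 0 are determined by the product.
   Finally, since V_4(A) always has points over K when det A = 1, density in
   V_k(A) implies that V_k(A) has an O-point, and padding it with zeros gives
   the first claim from the second. *)

Require Import Defs.
From HB Require Import structures.
From mathcomp Require Import all_boot all_order all_algebra all_field.
From mathcomp Require Import boolp classical_sets functions cardinality.
From mathcomp Require Import mpoly ring.

Set Implicit Arguments.
Unset Strict Implicit.
Unset Printing Implicit Defensive.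

Import Order.TTheory GRing.Theory Num.Theory.

Local Open Scope ring_scope.

(** * Zariski closure and rational curves *)

Section Zariski_closure.

Variable F : fieldType.

(** Sequences have no fixed length and absent coordinates read as 0, so adding or removing a first
    coordinate requires no reindexing of variables. *)
Inductive polyfun : (seq F -> F) -> Prop :=
| polyfun_const c : polyfun (fun=> c)
| polyfun_nth i : polyfun (fun s => s`_i)
| polyfun_add f g : polyfun f -> polyfun g -> polyfun (fun s => f s + g s)
| polyfun_mul f g : polyfun f -> polyfun g -> polyfun (fun s => f s * g s)
| polyfun_ext f g : f =1 g -> polyfun f -> polyfun g.

Lemma polyfun_cons t f : polyfun f -> polyfun (fun s => f (t :: s)).
Proof.
elim=> [c|[|i]|{}f g _ Hf _ Hg|{}f g _ Hf _ Hg|{}f g efg _ Hf] /=.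
- exact: polyfun_const.
- exact: polyfun_const.
- exact: polyfun_nth.
- exact: polyfun_add.
- exact: polyfun_mul.
- by apply: polyfun_ext Hf => s; rewrite efg.
Qed.

Lemma polyfun_meval k (p : {mpoly F[k]}) :
  polyfun (fun s => p.@[fun i : 'I_k => s`_i]).
Proof.
have sumP (I : Type) (r : seq I) (f : I -> seq F -> F) :
    (forall i, polyfun (f i)) -> polyfun (fun s => \sum_(i <- r) f i s).
  move=> fP; elim: r => [|i r IHr].
    by apply: polyfun_ext (polyfun_const 0) => s; rewrite big_nil.
  by apply: polyfun_ext (polyfun_add (fP i) IHr) => s; rewrite big_cons.
have prodP (I : Type) (r : seq I) (f : I -> seq F -> F) :
    (forall i, polyfun (f i)) -> polyfun (fun s => \prod_(i <- r) f i s).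
  move=> fP; elim: r => [|i r IHr].
    by apply: polyfun_ext (polyfun_const 1) => s; rewrite big_nil.
  by apply: polyfun_ext (polyfun_mul (fP i) IHr) => s; rewrite big_cons.
apply: (@polyfun_ext
  (fun s => \sum_(m <- msupp p) p@_m * \prod_(i < k) s`_i ^+ m i)).
  by move=> s; rewrite mevalE.
apply: sumP => m; apply: polyfun_mul; first exact: polyfun_const.
apply: prodP => i; elim: (m i) => [|n IHn].
  by apply: polyfun_ext (polyfun_const 1) => s; rewrite expr0.
by apply: polyfun_ext (polyfun_mul (polyfun_nth i) IHn) => s; rewrite exprS.
Qed.

Definition zclosure (Z : seq F -> Prop) (y : seq F) : Prop :=
  forall f, polyfun f -> (forall z, Z z -> f z = 0) -> f y = 0.

Lemma mem_zclosure (Z : seq F -> Prop) y : Z y -> zclosure Z y.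
Proof. by move=> Zy f _; apply. Qed.

Lemma zclosure_cons (Z Z' : seq F -> Prop) t y :
  (forall z, Z z -> Z' (t :: z)) -> zclosure Z y -> zclosure Z' (t :: y).
Proof.
by move=> ZZ' Zy f pf f0; apply: (Zy _ (polyfun_cons t pf)) => z /ZZ' /f0.
Qed.

Definition infinitely_many (T : F -> Prop) : Prop :=
  forall l : seq F, exists2 t, T t & t \notin l.

Lemma infinitely_many_uniq (T : F -> Prop) n : infinitely_many T ->
  exists s : seq F, [/\ size s = n, uniq s & forall t, t \in s -> T t].
Proof.
move=> Tinf; elim: n => [|n [s [sz us Ts]]]; first by exists [::].
have [t Tt ts] := Tinf s; exists (t :: s); rewrite /= sz ts us; split=> // u.
by rewrite inE => /predU1P[->|/Ts].
Qed.

Lemma poly_infinitely_many_roots (T : F -> Prop) (p : {poly F}) :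
  infinitely_many T -> (forall t, T t -> p.[t] = 0) -> p = 0.
Proof.
move=> Tinf p0; have [s [sz us Ts]] := infinitely_many_uniq (size p) Tinf.
apply/eqP; apply: contraFT (ltnn (size p)) => nz; rewrite -{1}sz.
by rewrite max_poly_roots //; apply/allP => t /Ts /p0 /rootP.
Qed.

(* Only denominators that are powers of [Q] are allowed. *)
Definition ratfun (Q : {poly F}) (g : F -> F) : Prop :=
  exists n, exists G : {poly F},
    forall s, Q.[s] != 0 -> g s * Q.[s] ^+ n = G.[s].

Lemma ratfun_poly Q (p : {poly F}) : ratfun Q (horner p).
Proof. by exists 0%N, p => s _; rewrite mulr1. Qed.

Lemma ratfun_ext Q g h : g =1 h -> ratfun Q g -> ratfun Q h.
Proof. by move=> egh [n [G HG]]; exists n, G => s; rewrite -egh; apply: HG. Qed.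

Lemma ratfun_const Q c : ratfun Q (fun=> c).
Proof. by apply: ratfun_ext (ratfun_poly Q c%:P) => s; rewrite hornerC. Qed.

Lemma ratfun_id Q : ratfun Q id.
Proof. by apply: ratfun_ext (ratfun_poly Q 'X) => s; rewrite hornerX. Qed.

Lemma ratfun_add Q g h :
  ratfun Q g -> ratfun Q h -> ratfun Q (fun s => g s + h s).
Proof.
move=> [n [G HG]] [m [H HH]]; exists (n + m)%N, (G * Q ^+ m + H * Q ^+ n).
by move=> s Qs; rewrite !hornerE -HG // -HH // !exprD; ring.
Qed.

Lemma ratfun_mul Q g h :
  ratfun Q g -> ratfun Q h -> ratfun Q (fun s => g s * h s).
Proof.
move=> [n [G HG]] [m [H HH]]; exists (n + m)%N, (G * H).
by move=> s Qs; rewrite !hornerE -HG // -HH // !exprD; ring.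
Qed.

Lemma ratfun_opp Q g : ratfun Q g -> ratfun Q (fun s => - g s).
Proof.
by move=> [n [G HG]]; exists n, (- G) => s Qs; rewrite hornerN -HG // mulNr.
Qed.

Lemma ratfun_inv (Q : {poly F}) : ratfun Q (fun s => Q.[s]^-1).
Proof. by exists 1%N, 1 => s Qs; rewrite expr1 mulVf // hornerC. Qed.

Lemma ratfun_polyfun Q (gamma : F -> seq F) f : polyfun f ->
  (forall i, ratfun Q (fun s => (gamma s)`_i)) ->
  ratfun Q (fun s => f (gamma s)).
Proof.
move=> pf gP; elim: pf => //.
- exact: ratfun_const.
- by move=> f1 f2 _ H1 _ H2; apply: ratfun_add.
- by move=> f1 f2 _ H1 _ H2; apply: ratfun_mul.
- by move=> f1 f2 e12 _; apply: ratfun_ext => s; rewrite e12.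
Qed.

(** On the curve, [f] times a power of [Q] agrees with a polynomial [G] wherever [Q] is nonzero.
    Then [G * Q] vanishes on all of [T], so [G = 0], and the power of [Q] can be divided out at
    [s0]. *)
Lemma zclosure_curve Z (T : F -> Prop) (Q : {poly F}) (gamma : F -> seq F) s0 :
    infinitely_many T -> Q.[s0] != 0 ->
    (forall i, ratfun Q (fun s => (gamma s)`_i)) ->
    (forall s, T s -> Q.[s] != 0 -> zclosure Z (gamma s)) ->
  zclosure Z (gamma s0).
Proof.
move=> Tinf Qs0 gP TZ f pf f0; have [n [G HG]] := ratfun_polyfun pf gP.
have : G * Q = 0.
  apply: (poly_infinitely_many_roots Tinf) => s Ts; rewrite hornerM.
  have [->|Qs] := eqVneq Q.[s] 0; first by rewrite mulr0.
  by rewrite -HG // (TZ s Ts Qs f pf f0) !mul0r.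
have nzQ : Q != 0 by apply: contra_neq Qs0 => ->; rewrite horner0.
move/eqP; rewrite mulf_eq0 (negPf nzQ) orbF => /eqP G0.
have /eqP := HG s0 Qs0; rewrite G0 horner0 mulf_eq0.
by rewrite expf_eq0 (negPf Qs0) andbF orbF => /eqP.
Qed.

End Zariski_closure.

(* The entries [(a, b, c, d)] of the product [L s_0 *m U s_1 *m L s_2 *m ...].
   Exchanging the two basis vectors exchanges [L] and [U], so the product
   starting with [U] is the one starting with [L] with its entries reversed. *)
Fixpoint chain (F : nzRingType) (s : seq F) : F * F * F * F :=
  if s is t :: s' then
    let: (a, b, c, d) := chain s' in (d, c, b + t * d, a + t * c)
  else (1, 0, 0, 1).

Lemma chain_cons_inj (F : nzRingType) (t : F) r s :
  chain (t :: r) = chain (t :: s) -> chain r = chain s.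
Proof.
rewrite /=; case: (chain r) => [[[a b] c] d]; case: (chain s) => [[[p q] u] v].
by move=> [-> -> /addIr -> /addIr ->].
Qed.

Lemma chain_cons (F : nzRingType) (t : F) r s :
  chain r = chain s -> chain (t :: r) = chain (t :: s).
Proof. by rewrite /= => ->. Qed.

(** * Deformations of factorizations with a fixed product *)

Section Deformations.

Variable F : fieldType.
Implicit Types (r : seq F) (e x y : F).

(** Moving [L e] to the other side subtracts [e] times the first row from the second in the product
    of the next three factors. Its lower left entry [y3] becomes [x3] and its upper left entry
    [1 + y2 * y3] stays, whence the formulas. *)
Lemma chain_deform4 e y1 y2 y3 y4 r (x3 := y3 - (1 + y2 * y3) * e) :
  x3 != 0 ->
  chain [:: y1 + e, y2 * y3 / x3, x3, y4 - e * y2 / x3 & r]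
  = chain [:: y1, y2, y3, y4 & r].
Proof.
rewrite /= => nz; case: (chain r) => [[[a b] c] d].
congr (_, _, _, _); rewrite /x3; field; exact: nz.
Qed.

(** For a zero third coordinate, the denominator in [chain_deform4] is [- e], which vanishes at the
    starting point. Spreading the change over five coordinates leaves the denominators [y4] and [w],
    and [w] is 1 at [e = 0]. *)
Lemma chain_deform5 e y1 y2 y4 y5 r (w := 1 - y2 * e) :
  y4 != 0 -> w != 0 ->
  chain [:: y1 + e, y2 / w, - e * ((y2 + y4) / y4) * w, y4 / w,
            y5 + y2 / y4 * e & r]
  = chain [:: y1, y2, 0, y4, y5 & r].
Proof.
rewrite /= => nz4 nz; case: (chain r) => [[[a b] c] d].
congr (_, _, _, _); rewrite /w; field; rewrite ?nz4 ?nz //.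
Qed.

Lemma chain_merge y1 y2 y4 e r :
  chain [:: y1, y2 + y4 - e, 0, e & r] = chain [:: y1, y2, 0, y4 & r].
Proof.
by rewrite /=; case: (chain r) => [[[a b] c] d]; congr (_, _, _, _); ring.
Qed.

Lemma chain_split y1 y2 y4 e r :
  chain [:: y1 + e, 0, - e, y2 + y4 & r] = chain [:: y1, y2, 0, y4 & r].
Proof.
by rewrite /=; case: (chain r) => [[[a b] c] d]; congr (_, _, _, _); ring.
Qed.

(** This is [chain_deform4] at [e = - m * x3] with the common factor [x3] cancelled, so that the
    only denominator left is a unit. *)
Lemma chain_unit m v x1 x2 x3 x4 r : (1 + (1 + x2 * x3) * m) * v = 1 ->
  chain [:: x1 - m * x3, x2 * v, x3 * (1 + (1 + x2 * x3) * m),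
            x4 + m * (x2 * v) & r]
  = chain [:: x1, x2, x3, x4 & r].
Proof.
move=> uv; have nz : 1 + (1 + x2 * x3) * m != 0.
  by apply: contra_eq_neq uv => ->; rewrite mul0r eq_sym oner_neq0.
have -> : v = (1 + (1 + x2 * x3) * m)^-1.
  by apply: (mulfI nz); rewrite uv mulfV.
rewrite /=; case: (chain r) => [[[a b] c] d].
by congr (_, _, _, _); field.
Qed.

(** The product has upper right entry [x2] and diagonal entries [1 + x2 * x3] and [1 + x1 * x2]. *)
Lemma chain3_inj y1 y2 y3 x1 x2 x3 : y2 != 0 ->
  chain [:: x1; x2; x3] = chain [:: y1; y2; y3] ->
  [:: x1; x2; x3] = [:: y1; y2; y3].
Proof.
move=> nz2 /= []; rewrite !(mul0r, mulr0, mulr1, addr0, add0r).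
move=> /addrI + e2 _ /addrI; rewrite {}e2 => /(mulfI nz2) -> /(mulIf nz2) ->.
by [].
Qed.

End Deformations.

(** * Density of integral points *)

Section Density.

Variables (F : fieldType) (R : subringClosed F).

Lemma infinitely_many_inj (T T' : F -> Prop) (f : F -> F) : injective f ->
  (forall t, T t -> T' (f t)) -> infinitely_many T -> infinitely_many T'.
Proof.
move=> injf TT' Tinf l.
have [s [sz us Ts]] := infinitely_many_uniq (size l).+1 Tinf.
have /allPn[u /mapP[t /Ts Tt ->] ul] : ~~ all (mem l) (map f s).
  apply: contraFN (ltnn (size l)) => /allP sl.
  rewrite -{1}sz -(size_map f); apply: uniq_leq_size => //.
  by rewrite map_inj_uniq.
by exists (f t) => //; apply: TT'.
Qed.

Definition integral_point (k : nat) (A : F * F * F * F) (s : seq F) : Prop :=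
  [/\ size s = k, all (fun t => t \in R) s & chain s = A].

Lemma integral_point_cons t k A r s : t \in R -> chain (t :: r) = A ->
  integral_point k (chain r) s -> integral_point k.+1 A (t :: s).
Proof.
move=> Rt rA [sz Rs rs]; split; rewrite /= ?sz //; first by apply/andP.
by rewrite -rA; apply: chain_cons.
Qed.

(** The multiplier [m] is counted, not the unit [1 + a * m]; for [a = 0] this says that [R] is
    infinite. *)
Hypothesis congruence_units : forall a, a \in R ->
  infinitely_many
    (fun m => m \in R /\ exists2 v, v \in R & (1 + a * m) * v = 1).

Lemma infinitely_many_integers : infinitely_many (fun t => t \in R).
Proof.
apply: infinitely_many_inj (@inj_id F) _ (congruence_units (rpred0 R)).
by move=> t [].
Qed.

Lemma infinitely_many_fibers k A s :
    integral_point k.+4 A s ->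
  infinitely_many
    (fun t => t \in R /\ exists r, integral_point k.+4 A (t :: r)).
Proof.
case: s => [|x1 [|x2 [|x3 [|x4 r]]]] [] //= [sz].
case/and5P=> R1 R2 R3 R4 Rr xA.
have [x30|x3n0] := eqVneq x3 0.
  apply: infinitely_many_inj (addrI x1) _ infinitely_many_integers => e Re.
  split; first exact: rpredD.
  exists [:: 0, - e, x2 + x4 & r]; split; rewrite /= ?sz //.
    by rewrite !rpredD // rpred0 rpredN Re.
  by rewrite -xA x30; apply: chain_split.
have Ra : 1 + x2 * x3 \in R by rewrite rpredD ?rpred1 ?rpredM.
apply: (@infinitely_many_inj _ _ (fun m => x1 - m * x3)) (congruence_units Ra).
  by move=> m n /addrI/oppr_inj; apply: (mulIf x3n0).
move=> m [Rm [v Rv uv]]; split; first by rewrite rpredB ?rpredM.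
exists [:: x2 * v, x3 * (1 + (1 + x2 * x3) * m), x4 + m * (x2 * v) & r].
split; rewrite /= ?sz //; last by rewrite -xA; apply: chain_unit.
have Ru : 1 + (1 + x2 * x3) * m \in R by rewrite rpredD ?rpred1 ?rpredM.
by rewrite rpredB ?rpredD ?rpredM.
Qed.

(* The curve is parametrized by the increment of the first coordinate, so it
   meets almost all of the fibers that contain integral points. *)
Lemma zclosure_fibration k A (Q : {poly F}) (gamma : F -> seq F) s0 y1 :
    (exists s, integral_point k.+4 A s) -> Q.[0] != 0 ->
    (forall i, ratfun Q (fun e => (y1 + e :: gamma e)`_i)) ->
    (forall e, Q.[e] != 0 -> chain (y1 + e :: gamma e) = A) ->
    (forall e r, Q.[e] != 0 -> integral_point k.+3 (chain (gamma e)) r ->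
      zclosure (integral_point k.+3 (chain (gamma e))) (gamma e)) ->
    y1 :: gamma 0 = s0 ->
  zclosure (integral_point k.+4 A) s0.
Proof.
move=> [s As] Q0 gP gA fibP <-; rewrite -[y1 in y1 :: _]addr0.
apply: (zclosure_curve _ Q0 gP (T := fun e => y1 + e \in R /\
  exists r, integral_point k.+4 A (y1 + e :: r))).
  apply: infinitely_many_inj (addIr (- y1)) _ (infinitely_many_fibers As) => t.
  by rewrite addrC subrK.
move=> e [Rt [r [[szr] /andP[_ Rr] rA]]] Qe.
apply: (zclosure_cons (fun z => integral_point_cons Rt (gA e Qe))).
(* The first factor cancels, so the tail of an integral point over [y1 + e] is an integral point for
   the product of [gamma e]. *)
apply: (fibP e r Qe); split=> //; apply: chain_cons_inj (y1 + e) _ _ _.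
by rewrite rA gA.
Qed.

(** The curve is that of [chain_deform4]. The induction hypothesis is restricted to points with
    nonzero second coordinate, here [Q.[e]], so that it can also be supplied for triples. *)
Lemma zclosure_integral_points_neq0 k A (y1 y2 y3 y4 : F) r :
    (forall A' y z, integral_point k.+3 A' z -> size y = k.+3 -> chain y = A' ->
       y`_1 != 0 -> zclosure (integral_point k.+3 A') y) ->
    (exists s, integral_point k.+4 A s) -> size r = k ->
    chain [:: y1, y2, y3, y4 & r] = A -> y3 != 0 ->
  zclosure (integral_point k.+4 A) [:: y1, y2, y3, y4 & r].
Proof.
move=> IH As szr yA nz3; pose Q := y3%:P - (1 + y2 * y3)%:P * 'X.
have QE e : Q.[e] = y3 - (1 + y2 * y3) * e by rewrite !hornerE.
apply: (@zclosure_fibration k A Q (fun e =>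
  [:: y2 * y3 / Q.[e], Q.[e], y4 - e * y2 / Q.[e] & r]) _ y1) => //.
- by rewrite QE mulr0 subr0.
- case=> [|[|[|[|i]]]] /=; last exact: ratfun_const.
  + by apply: ratfun_add; [exact: ratfun_const | exact: ratfun_id].
  + by apply: ratfun_mul; [exact: ratfun_const | exact: ratfun_inv].
  + exact: ratfun_poly.
  + apply: ratfun_add; first exact: ratfun_const.
    apply/ratfun_opp/ratfun_mul; last exact: ratfun_inv.
    by apply: ratfun_mul; [exact: ratfun_id | exact: ratfun_const].
- by move=> e; rewrite QE -yA; apply: chain_deform4.
- by move=> e z Qe Az; apply: IH Az _ _ _ => //=; rewrite szr.
- by rewrite QE !(mulr0, mul0r, subr0) mulfK.
Qed.

(** If [y3 != 0], the points in the fibers are determined by their products, hence are integral. If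
    [y3 = 0], comparing entries with an integral point puts [y1] and [y2 + y4] in [R], and the line
    of [chain_merge] is integral for [e] in [R]. *)
Lemma zclosure_integral_points4 A y : (exists s, integral_point 4 A s) ->
  size y = 4 -> chain y = A -> zclosure (integral_point 4 A) y.
Proof.
case: y => [|y1 [|y2 [|y3 [|y4 []]]]] // As _ yA.
have [y30|nz3] := eqVneq y3 0; last first.
  apply: zclosure_integral_points_neq0 => // A' y z A'z szy yA' nz.
  suff -> : y = z by apply: mem_zclosure.
  move: A'z szy yA' nz => [].
  case: y z => [|u1 [|u2 [|u3 []]]] // [|z1 [|z2 [|z3 []]]] // _ _ <- _ uz nz.
  exact/esym/chain3_inj.
case: As => -[|x1 [|x2 [|x3 [|x4 [|x5 r]]]]] [] //= _ /and5P[R1 R2 R3 R4 _] xA.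
have [yE1 yE2 xE] : [/\ y2 + y4 = x2 + x4 * (1 + x2 * x3), y1 = x1 + x3
    & x2 * x3 = 0].
  move: (xA); rewrite -yA y30 /= !(mulr0, mul0r, addr0, add0r, mulr1).
  move=> [a1 b1 c1 _]; have x0 : x2 * x3 = 0.
    by apply: (addrI 1); rewrite a1 addr0.
  by split=> //; [rewrite addrC -b1 | rewrite -c1 x0]; ring.
rewrite -(addrK y4 y2) y30.
apply: (@zclosure_curve _ _ (fun e => e \in R) 1
  (fun e => [:: y1; y2 + y4 - e; 0; e])).
- exact: infinitely_many_integers.
- by rewrite hornerC oner_neq0.
- case=> [|[|[|[|i]]]] /=; do ?exact: ratfun_const.
  + apply: ratfun_add; [exact: ratfun_const | exact/ratfun_opp/ratfun_id].
  + exact: ratfun_id.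
- move=> e Re _; apply: mem_zclosure; split=> //.
    rewrite /= rpred0 Re yE1 yE2 !rpredD ?rpredN ?rpredM //.
    by rewrite xE addr0 rpred1.
  by rewrite -yA y30; apply: chain_merge.
Qed.

Theorem zclosure_integral_points k A y : (exists s, integral_point k.+4 A s) ->
  size y = k.+4 -> chain y = A -> zclosure (integral_point k.+4 A) y.
Proof.
elim: k A y => [|k IHk] A y; first exact: zclosure_integral_points4.
case: y => [|y1 [|y2 [|y3 [|y4 [|y5 r]]]]] // As [szr] yA.
have IH A' y z : integral_point k.+4 A' z -> size y = k.+4 -> chain y = A' ->
    zclosure (integral_point k.+4 A') y.
  by move=> A'z; apply: IHk; exists z.
have [y30|nz3] := eqVneq y3 0; last first.
  apply: zclosure_integral_points_neq0 => //=.
    by move=> A' u z ? ? ? _; apply: (IH A' u z).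
  by rewrite szr.
move: yA; rewrite {}y30 => yA.
(* On the line of [chain_merge] the fourth coordinate is the parameter, so a point with [y4 = 0] is
   reached from points with [y4 != 0]. *)
wlog nz4 : y2 y4 yA / y4 != 0 => [wl|].
  have [y40|] := eqVneq y4 0; last exact: wl.
  rewrite -(addrK y4 y2).
  apply: (@zclosure_curve _ _ (fun e => e != 0) 1
    (fun e => [:: y1, y2 + y4 - e, 0, e, y5 & r])).
  - move=> l; have [e _] := infinitely_many_integers (0 :: l).
    by rewrite inE negb_or => /andP[]; exists e.
  - by rewrite hornerC oner_neq0.
  - case=> [|[|[|[|i]]]] /=; do ?exact: ratfun_const.
    + apply: ratfun_add; [exact: ratfun_const | exact/ratfun_opp/ratfun_id].
    + exact: ratfun_id.
  - by move=> e nze _; apply: wl => //; rewrite chain_merge.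
(* The curve of [chain_deform5], with [Q] its denominator [w]. *)
pose Q := 1%:P - y2%:P * 'X.
have QE e : Q.[e] = 1 - y2 * e by rewrite !hornerE.
apply: (@zclosure_fibration k.+1 A Q (fun e =>
  [:: y2 / Q.[e], - e * ((y2 + y4) / y4) * Q.[e], y4 / Q.[e],
      y5 + y2 / y4 * e & r]) _ y1) => //.
- by rewrite QE mulr0 subr0 oner_neq0.
- case=> [|[|[|[|[|i]]]]] /=; last exact: ratfun_const.
  + by apply: ratfun_add; [exact: ratfun_const | exact: ratfun_id].
  + by apply: ratfun_mul; [exact: ratfun_const | exact: ratfun_inv].
  + apply: ratfun_mul; last exact: ratfun_poly.
    by apply: ratfun_mul; [exact/ratfun_opp/ratfun_id | exact: ratfun_const].
  + by apply: ratfun_mul; [exact: ratfun_const | exact: ratfun_inv].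
  + apply: ratfun_add; first exact: ratfun_const.
    by apply: ratfun_mul; [exact: ratfun_const | exact: ratfun_id].
- by move=> e; rewrite QE -yA; apply: chain_deform5.
- by move=> e z Qe Az; apply: (IH _ _ z) => //=; rewrite szr.
- by rewrite QE !(mulr0, mul0r, oppr0, subr0, addr0, divr1).
Qed.

End Density.

(** * Units in congruence classes *)

Section Primitive_dependency.

Variable vT : vectType rat.

(** Denominators are cleared in a rational relation and the content is divided out; storing the
    coefficients in a polynomial gives access to [zcontents]. *)
Lemma primitive_dependency n (X : n.-tuple vT) : ~~ free X ->
  exists c : {poly int}, [/\ (size c <= n)%N, zcontents c = 1
    & \sum_(i < n) X`_i *~ c`_i = 0].
Proof.
move=> /freeP nfree; have {nfree}[k k0 [j kj]] : exists2 k : 'I_n -> rat,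
    \sum_(i < n) k i *: X`_i = 0 & exists i, k i <> 0.
  apply: contrapT => H; apply: nfree => k k0 i.
  by apply: contrapT => ki; apply: H; exists k => //; exists i.
pose P := rVpoly (\row_i k i).
have PE i : P`_(i : 'I_n) = k i by rewrite coef_rVpoly_ord mxE.
have [q [a nz_a DP]] := rat_poly_scale P.
have nz_q : q != 0.
  apply: contra_not_neq kj => q0; rewrite -PE DP q0 map_poly0 scaler0.
  by rewrite coef0.
exists (zprimitive q); split.
- rewrite size_zprimitive; have: (size P <= n)%N := size_poly _ _.
  rewrite DP size_scale ?invr_eq0 ?intr_eq0 //.
  by rewrite size_map_inj_poly //; exact: intr_inj.
- by rewrite zcontents_primitive nz_q.
pose b : rat := a%:~R^-1 * (zcontents q)%:~R.
have nz_b : b != 0 by rewrite mulf_neq0 ?invr_eq0 ?intr_eq0 // zcontents_eq0.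
apply: (scalerI nz_b); rewrite scaler0 -[RHS]k0 scaler_sumr.
apply: eq_bigr => i _.
rewrite -scaler_int scalerA -PE DP coefZ coef_map /=; congr (_ *: _).
have qi : q`_i = zcontents q * (zprimitive q)`_i.
  by rewrite {1}[q]zpolyEprim coefZ.
by rewrite -mulrA -intrM -qi.
Qed.

End Primitive_dependency.

(** * Finiteness of [O / aO] and units congruent to 1 *)

Section Finite_quotients.

Variables (K : fieldExtType rat) (O : subringClosed K).

Definition finite_quotient (a : K) : Prop :=
  exists2 reps : seq K, {subset reps <= O} &
    forall x, x \in O -> exists2 r, r \in reps &
      exists2 y, y \in O & x = r + a * y.

(** For prime [p] and [X] in [O], linear independence over the field with [p] elements in [O / pO].
    Indexing [c] by [nat] lets it shift when [X] gets a new head. *)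
Definition free_mod (p : nat) (X : seq K) : Prop :=
  forall c : nat -> int,
    (exists2 y, y \in O & \sum_(i < size X) X`_i *~ c i = p%:R * y) ->
  forall i : 'I_(size X), (p %| c i)%Z.

(* A primitive integral relation remains nontrivial modulo every prime, so
   [O / pO] has dimension at most [K : Q] over [F_p], even though [O] need not
   be finitely generated as an abelian group. *)
Lemma free_mod_size p X : prime p -> free_mod p X -> (size X <= \dim {:K})%N.
Proof.
move=> pr_p Xp; suff /eqnP <- : free X by rewrite dimvS ?subvf.
apply/negPn/negP => nfX.
have [c [szc c1 c0]] : exists c : {poly int}, [/\ (size c <= size X)%N,
    zcontents c = 1 & \sum_(i < size X) X`_i *~ c`_i = 0].
  exact: (@primitive_dependency _ _ (in_tuple X)).
have pc (i : 'I_(size X)) : (p %| c`_i)%Z.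
  by apply: (Xp (fun i => c`_i)); exists 0; rewrite ?rpred0 ?mulr0.
suff: (p %| zcontents c)%Z.
  by rewrite c1 dvdz1 absz_nat => /eqP p1; rewrite p1 in pr_p.
rewrite dvdz_contents; apply/polyOverP => i.
have [ltiX|leXi] := ltnP i (size X); first exact: pc (Ordinal ltiX).
by rewrite nth_default ?(leq_trans szc) // dvdz0.
Qed.

Lemma maximal_free_mod p : prime p ->
  exists X, [/\ {subset X <= O}, free_mod p X &
    forall x, x \in O -> ~ free_mod p (x :: X)].
Proof.
move=> pr_p; apply: contrapT => nmax.
have [X [_ Xp szX]] : exists X,
    [/\ {subset X <= O}, free_mod p X & size X = (\dim {:K}).+1].
  elim: (_.+1) => [|n [X [XO Xp szX]]].
    by exists [::]; split=> // c _ [].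
  apply: contrapT => nX; apply: nmax; exists X; split=> // x Ox xXp.
  apply: nX; exists (x :: X); rewrite /= szX; split=> // y.
  by rewrite inE => /predU1P[->|/XO].
by have := free_mod_size pr_p Xp; rewrite szX ltnn.
Qed.

(** A maximal free family spans [O / pO], so its combinations with coefficients below [p] represent
    all classes. *)
Lemma finite_quotient_prime p : prime p -> finite_quotient p%:R.
Proof.
move=> pr_p; have [X [XO Xp Xmax]] := maximal_free_mod pr_p.
have OX i : X`_i \in O.
  have [ltiX|leXi] := ltnP i (size X); first by rewrite XO ?mem_nth.
  by rewrite nth_default ?rpred0.
pose comb (f : {ffun 'I_(size X) -> 'I_p}) := \sum_(i < size X) X`_i *+ f i.
exists [seq comb f | f : {ffun 'I_(size X) -> 'I_p}].
  by move=> _ /mapP[f _ ->]; rewrite rpred_sum // => i _; rewrite rpredMn.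
move=> x Ox.
have [c [y Oy]] : exists c : nat -> int,
    exists2 y, y \in O & x = \sum_(i < size X) X`_i *~ c i + p%:R * y.
  have [c [y Oy cE] [i pci]] : exists2 c : nat -> int,
      exists2 y, y \in O &
        \sum_(i < size (x :: X)) (x :: X)`_i *~ c i = p%:R * y
      & exists i : 'I_(size (x :: X)), ~~ (p %| c i)%Z.
    apply: contrapT => H; apply: (Xmax x Ox) => c cy i.
    by apply: contrapT => /negP pci; apply: H; exists c => //; exists i.
  move: cE; rewrite big_ord_recl /=.
  under eq_bigr do rewrite /bump /=.
  set Sc := \sum_(_ < _) _ => cE.
  have ScE : Sc = p%:R * y - x *~ c 0%N by rewrite -cE addrC addKr.
  (* If [p] divided the coefficient of [x], the relation would descend to [X], and freeness would
     make [p] divide all the others. *)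
  have pc0 : ~~ (p %| c 0%N)%Z.
    apply: contra pci => /[dup] pc0 /dvdzP[e Dc0].
    case: i => -[|i] //= ltiX.
    apply: (Xp (fun i => c i.+1) _ (Ordinal (ltiX : (i < size X)%N))).
    exists (y - x *~ e); first by rewrite rpredB ?rpredMz.
    by rewrite -[LHS]/Sc ScE Dc0 mulrzA -pmulrn -(mulr_natl (x *~ e)) mulrBr.
  (* Bezout inverts the coefficient of [x] modulo [p], which solves the relation for [x]. *)
  have /coprimezP[[u v] /= uv] : coprimez p (c 0%N).
    by rewrite coprimezE prime_coprime.
  exists (fun i => - (c i.+1 * v)), (x *~ u + y *~ v).
    by rewrite rpredD ?rpredMz.
  have -> : \sum_(i < size X) X`_i *~ - (c i.+1 * v) = - Sc *~ v.
    rewrite mulNrz /Sc mulrz_suml -sumrN; apply: eq_bigr => j _.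
    by rewrite mulrNz mulrzA.
  rewrite ScE -[LHS]mulr1z -uv mulrzDr (mulrC v) !mulrzA -pmulrn.
  rewrite -(mulr_natl (x *~ u)) mulNrz mulrzBl opprB mulrDr !mulrzAr.
  by rewrite [RHS]addrC addrACA subrr addr0.
pose m i := `|(c i %% p)%Z|%N.
have mE i : (c i %% p)%Z = m i.
  by rewrite /m gez0_abs // modz_ge0 // eqz_nat -lt0n prime_gt0.
have ltmp i : (m i < p)%N by rewrite -ltz_nat -mE ltz_pmod // ltz_nat prime_gt0.
move=> ->; exists (comb [ffun i => Ordinal (ltmp (i : 'I__))]).
  by apply: map_f; rewrite mem_enum.
exists (\sum_(i < size X) X`_i *~ (c i %/ p)%Z + y).
  by rewrite rpredD ?rpred_sum // => i _; rewrite rpredMz.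
rewrite mulrDr addrA; congr (_ + _); rewrite mulr_sumr -big_split /=.
apply: eq_bigr => i _; rewrite ffunE /= {1}(divz_eq (c i) p) mulrzDr addrC.
congr (_ + _).
  by rewrite mulrzA -pmulrn -[LHS]mulr_natl.
by rewrite mE -pmulrn.
Qed.

Lemma finite_quotientM a b : a \in O -> finite_quotient a ->
  finite_quotient b -> finite_quotient (a * b).
Proof.
move=> Oa [ra raO Hra] [rb rbO Hrb].
exists [seq r + a * s | r <- ra, s <- rb].
  by move=> _ /allpairsP[[r s] /= [/raO Or /rbO Os ->]]; rewrite rpredD ?rpredM.
move=> x /Hra[r rr [y /Hrb[s ss [z Oz ->]] ->]].
exists (r + a * s); first exact: allpairs_f.
by exists z => //; ring.
Qed.

Lemma finite_quotient_nat n : (0 < n)%N -> finite_quotient n%:R.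
Proof.
elim/ltn_ind: n => n IHn n_gt0; have [n1|n_gt1] := leqP n 1.
  have -> : n = 1%N by case: n n_gt0 n1 {IHn} => [|[]].
  exists [:: 0]; first by move=> x; rewrite inE => /eqP ->; rewrite rpred0.
  by move=> x Ox; exists 0; rewrite ?inE //; exists x; rewrite // mul1r add0r.
have pr_p := pdiv_prime n_gt1; have p_n := pdiv_dvd n.
rewrite -(divnK p_n) natrM mulrC; apply: finite_quotientM.
- exact: rpred_nat.
- exact: finite_quotient_prime.
apply: IHn; first by rewrite ltn_Pdiv ?prime_gt1.
by rewrite divn_gt0 ?pdiv_gt0 // dvdn_leq.
Qed.

(** The powers of [a] satisfy an integer relation. Since [a != 0], factors ['X] can be removed until
    the constant term is nonzero; that term is then [a] times an integer polynomial in [a], up to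
    sign. *)
Lemma integral_multiple a : a \in O -> a != 0 ->
  exists2 n, (0 < n)%N & exists2 b, b \in O & n%:R = a * b.
Proof.
move=> Oa nz_a; pose d := \dim {:K}; pose X := [tuple a ^+ i | i < d.+1].
have nfX : ~~ free X.
  apply/negP => /eqnP szX; have := dimvS (subvf <<X>>).
  by rewrite szX size_tuple ltnn.
have [c [szc c1 c0]] := primitive_dependency nfX.
have {c0} root_c : (map_poly intr c).[a] = 0.
  rewrite (@horner_coef_wide _ d.+1) ?(leq_trans (size_poly _ _)) //.
  rewrite -[RHS]c0; apply: eq_bigr => i _; rewrite coef_map /=.
  by rewrite (_ : X`_i = a ^+ i) ?mulrzl // -tnth_nth tnth_mktuple.
have nz_c : c != 0 by rewrite -zcontents_eq0 c1.
have [m [q]] := multiplicity_XsubC c 0; rewrite nz_c subr0 /= => q0 Dc.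
have root_q : (map_poly intr q).[a] = 0.
  move/eqP: root_c; rewrite Dc rmorphM rmorphXn /= map_polyX hornerM hornerXn.
  by rewrite mulf_eq0 expf_eq0 (negPf nz_a) andbF orbF => /eqP.
exists (absz q`_0); first by rewrite absz_gt0 -horner_coef0.
pose s := \poly_(i < size q) q`_i.+1.
have qE : q = (q`_0)%:P + s * 'X.
  apply/polyP => i; rewrite coefD coefC coefMX coef_poly.
  case: i => [|i] /=; first by rewrite addr0.
  by case: ltnP => [|leqi]; rewrite add0r // nth_default ?leqW.
have Os : (map_poly intr s).[a] \in O.
  rewrite rpred_horner //; apply/polyOverP => i; rewrite coef_map /=.
  exact: rpred_int.
exists (- ((-1) ^+ (q`_0 < 0)%R * (map_poly intr s).[a])).
  by rewrite rpredN rpredMsign.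
move/eqP: root_q; rewrite {1}qE rmorphD rmorphM /= map_polyC map_polyX !hornerE.
rewrite addr_eq0 => /eqP q0E; rewrite pmulrn abszEsign intrM rmorph_sign q0E.
by ring.
Qed.

(** With [n = a * b], the ring [O / aO] is a quotient of [O / nO]. *)
Lemma finite_quotient_neq0 a : a \in O -> a != 0 -> finite_quotient a.
Proof.
move=> Oa nz_a; have [n n_gt0 [b Ob Dn]] := integral_multiple Oa nz_a.
have [reps repsO Hreps] := finite_quotient_nat n_gt0.
exists reps => // x /Hreps[r rr [y Oy ->]]; exists r => //.
by exists (b * y); rewrite ?rpredM // Dn mulrA.
Qed.

(** Units fall into finitely many classes modulo [a], and those in the class of a unit [u0] are
    [u0 * (1 + a * m)] with an admissible [m]. If all such [m] were in [l], there would be finitely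
    many units. *)
Lemma congruence_units a : infinite_set (units_of O) -> a \in O ->
  forall l : seq K, exists2 m,
    m \in O /\ (exists2 v, v \in O & (1 + a * m) * v = 1) & m \notin l.
Proof.
move=> Uinf Oa l; have [->|nz_a] := eqVneq a 0.
  apply: contrapT => nm; apply: Uinf.
  apply: (sub_finite_set _ (finite_seq l)) => u [Ou _] /=.
  apply/negPn/negP => ul; apply: nm; exists u => //; split=> //.
  by exists 1; rewrite ?rpred1 // mul0r addr0 mulr1.
have [reps repsO Hreps] := finite_quotient_neq0 Oa nz_a.
apply: contrapT => nm; apply: Uinf.
pose C r : set K := fun u => units_of O u /\ exists2 y, y \in O & u = r + a * y.
apply: (@sub_finite_set _ _ (\bigcup_(r in [set` reps]) C r)%classic).
  move=> u [Ou Vu].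
  by have [r rr Hy] := Hreps u Ou; exists r.
apply: bigcup_finite; first exact: finite_seq.
move=> r _; have [->|/set0P] := eqVneq (C r) set0.
  exact: finite_set0.
move=> [u0 [[Ou0 [w Ow uw]] [y0 Oy0 Du0]]].
apply: (sub_finite_set _ (finite_seq [seq u0 * (1 + a * m) | m <- l])).
move=> u [[Ou [v Ov uv]] [y Oy Du]] /=.
have uE : u = u0 * (1 + a * ((y - y0) * w)).
  transitivity (u0 + a * (y - y0) * (u0 * w)); last by ring.
  by rewrite uw Du Du0; ring.
rewrite uE; apply/map_f/negPn/negP => ml; apply: nm.
exists ((y - y0) * w) => //; split; first by rewrite rpredM ?rpredB.
exists (v * u0); first by rewrite rpredM.
by rewrite -[RHS]uv [in RHS]uE; ring.
Qed.

End Finite_quotients.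

(** * Matrices and polynomials *)

Definition mx_entries (R : nzRingType) (A : 'M[R]_2) : R * R * R * R :=
  (A ord0 ord0, A ord0 ord_max, A ord_max ord0, A ord_max ord_max).

Lemma mx_entries_inj (R : nzRingType) : injective (@mx_entries R).
Proof.
move=> A B [e00 e01 e10 e11]; apply/matrixP => i j.
have ordE (k : 'I_2) : k = ord0 \/ k = ord_max.
  by case: k => -[|[|//]] lt2; [left | right]; apply: val_inj.
by case: (ordE i) => ->; case: (ordE j) => ->.
Qed.

Definition rev4 (T : Type) (q : T * T * T * T) :=
  let: (a, b, c, d) := q in (d, c, b, a).

Lemma mx_entriesM (R : nzRingType) (A B : 'M[R]_2) :
  mx_entries (A * B) =
    let: (a, b, c, d) := mx_entries A in let: (p, q, u, v) := mx_entries B in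
    (a * p + b * u, a * q + b * v, c * p + d * u, c * q + d * v).
Proof.
have e1 : lift ord0 (ord0 : 'I_1) = ord_max by apply: val_inj.
by rewrite /mx_entries -mulmxE !mxE !big_ord_recl !big_ord0 !addr0 !e1.
Qed.

(* [b = true] is the product starting with [U]. *)
Lemma mx_entries_prod (R : comNzRingType) (b : bool) k (x : 'I_k -> R) :
  mx_entries (\prod_(i < k) (if odd i (+) b then U_mx (x i) else L_mx (x i)))
  = (if b then @rev4 R else id) (chain [seq x i | i <- enum 'I_k]).
Proof.
elim: k x b => [|k IHk] x b.
  by rewrite big_ord0 enum_ord0 /mx_entries !mxE; case: b.
rewrite big_ord_recl enum_ordSl map_cons -map_comp mx_entriesM.
under eq_bigr do rewrite /bump addNb -addbN.
rewrite -/(mx_entries (\prod_(i < k) _)) (IHk (x \o lift ord0)) /=.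
case: (chain _) => [[[p q] u] v]; case: b => /=.
  by rewrite !mxE /= !(mul1r, mul0r, add0r).
by rewrite !mxE /= !(mul1r, mul0r, addr0) (addrC _ q) (addrC _ p).
Qed.

Lemma map_nth_enum_ord (T : Type) (x0 : T) k (s : seq T) :
  size s = k -> [seq nth x0 s (i : 'I_k) | i <- enum 'I_k] = s.
Proof.
by move=> <-; rewrite -[RHS](mkseq_nth x0) /mkseq -val_enum_ord -map_comp.
Qed.

Lemma V_pointsE (R : comNzRingType) k (A : 'M[R]_2) (x : 'I_k -> R) :
  V_points A x <-> chain [seq x i | i <- enum 'I_k] = mx_entries A.
Proof.
have := mx_entries_prod false x; under eq_bigr do rewrite addbF.
move=> /= <-; rewrite /V_points.
by split=> [<-//|/mx_entries_inj].
Qed.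

Lemma meval_map_mpoly (R S : fieldType) (f : {rmorphism R -> S}) k
    (p : {mpoly R[k]}) (v : 'I_k -> R) :
  (map_mpoly f p).@[f \o v] = f p.@[v].
Proof.
rewrite !mevalE (perm_big _ (msupp_map_mpoly p (fmorph_inj f))) /= rmorph_sum.
apply: eq_bigr => m _; rewrite mcoeff_map_mpoly rmorphM rmorph_prod.
by congr (_ * _); apply: eq_bigr => i _; rewrite rmorphXn.
Qed.

Lemma chain_map (R S : nzRingType) (f : {rmorphism R -> S}) s :
  chain (map f s) =
    let: (a, b, c, d) := chain s in (f a, f b, f c, f d).
Proof.
elim: s => [|t s IHs] /=; first by rewrite rmorph0 rmorph1.
by rewrite IHs; case: (chain s) => [[[a b] c] d]; rewrite !rmorphD !rmorphM.
Qed.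

(** * Rings of integers and their images under embeddings *)

Lemma S_integers_subring_closed (K : fieldExtType rat) (S : set (prime_of K)) :
  subring_closed (S_integers S).
Proof.
have ord1 (v : finite_prime K) : v 1 = 0.
  have := ord_atM v (oner_neq0 K) (oner_neq0 K).
  by rewrite mulr1 -[LHS]addr0 => /addrI.
have ordN (v : finite_prime K) x : v (- x) = v x.
  have [->|nz_x] := eqVneq x 0; first by rewrite oppr0.
  have nzN1 : -1 != 0 :> K by rewrite oppr_eq0 oner_neq0.
  have : v (-1) + v (-1) = 0 by rewrite -ord_atM // mulrNN mulr1 ord1.
  move/eqP; rewrite -mulr2n mulrn_eq0 /= => /eqP vN1.
  by rewrite -mulN1r ord_atM // vN1 add0r.
split=> [|x y /asboolP Ox /asboolP Oy|x y /asboolP Ox /asboolP Oy].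
- by apply/asboolP => v _; rewrite ord1.
- apply/asboolP => v Sv; have [->|nz_x] := eqVneq x 0.
    by rewrite sub0r ordN Oy.
  have [->|nz_y] := eqVneq y 0; first by rewrite subr0 Ox.
  have [->|nz_xy] := eqVneq (x - y) 0; first by rewrite ord_at0.
  apply: le_trans (ord_atD v nz_x _ nz_xy); last by rewrite oppr_eq0.
  by rewrite ordN le_min Ox ?Oy.
- apply/asboolP => v Sv; have [->|nz_x] := eqVneq x 0.
    by rewrite mul0r ord_at0.
  have [->|nz_y] := eqVneq y 0; first by rewrite mulr0 ord_at0.
  by rewrite ord_atM // addr_ge0 ?Ox ?Oy.
Qed.

HB.instance Definition _ (K : fieldExtType rat) (S : set (prime_of K)) :=
  GRing.isSubringClosed.Build K (S_integers S) (S_integers_subring_closed S).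

(** The density argument takes place in a single field, so [O] is carried into [F] as a subring. *)
Definition image_pred (K F : fieldType) (f : {rmorphism K -> F})
    (O : {pred K}) : {pred F} :=
  fun z => `[< exists2 x, x \in O & z = f x >].

Lemma image_subring_closed (K F : fieldType) (f : {rmorphism K -> F})
  (O : subringClosed K) : subring_closed (image_pred f O).
Proof.
split=> [|_ _ /asboolP[x Ox ->] /asboolP[y Oy ->]|
  _ _ /asboolP[x Ox ->] /asboolP[y Oy ->]]; apply/asboolP.
- by exists 1; rewrite ?rpred1 ?rmorph1.
- by exists (x - y); rewrite ?rpredB ?rmorphB.
- by exists (x * y); rewrite ?rpredM ?rmorphM.
Qed.

HB.instance Definition _ (K F : fieldType) (f : {rmorphism K -> F})
    (O : subringClosed K) :=
  GRing.isSubringClosed.Build F (image_pred f O) (image_subring_closed f O).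

Section Image.

Variables (K : fieldExtType rat) (F : fieldType) (f : {rmorphism K -> F}).
Variable O : subringClosed K.
Hypothesis units_infinite : infinite_set (units_of O).

Lemma congruence_units_image a : a \in image_pred f O ->
  infinitely_many (fun m => m \in image_pred f O /\
    exists2 v, v \in image_pred f O & (1 + a * m) * v = 1).
Proof.
move=> /asboolP[{}a Oa ->] l.
have [l' Hl'] : exists l' : seq K, forall m, f m \in l -> m \in l'.
  elim: l => [|z l [l' IHl]]; first by exists [::].
  have [[x ->]|nx] := pselect (exists x, z = f x).
    exists (x :: l') => m; rewrite !inE => /predU1P[/fmorph_inj ->|/IHl ->].
      by rewrite eqxx.
    by rewrite orbT.
  exists l' => m; rewrite inE => /predU1P[fm|/IHl//].
  by case: nx; exists m.
have [m [Om [v Ov uv]] ml] := congruence_units units_infinite Oa l'.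
exists (f m); last by apply: contra ml => /Hl'.
split; first by apply/asboolP; exists m.
exists (f v); first by apply/asboolP; exists v.
by rewrite -rmorphM -(rmorph1 f) -rmorphD -rmorphM uv.
Qed.

Lemma integral_point_image k (A : 'M[K]_2) s :
    integral_point (image_pred f O) k (mx_entries (map_mx f A)) s ->
  exists2 x : 'I_k -> K, V_O_points O A x & s = [seq f (x i) | i <- enum 'I_k].
Proof.
move=> [szs Os sA]; have [r Or Ds] : exists2 r, {subset r <= O} & s = map f r.
  elim: s Os {szs sA} => [|z s IHs] /=; first by exists [::].
  move=> /andP[/asboolP[x Ox ->] /IHs[r Or ->]]; exists (x :: r) => // y.
  by rewrite inE => /predU1P[->|/Or].
have szr : size r = k by rewrite -szs Ds size_map.
have rE := map_nth_enum_ord 0 szr.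
exists (fun i => r`_i); last by rewrite Ds -[in LHS]rE -map_comp.
split=> [|i]; last by rewrite Or ?mem_nth ?szr.
apply/V_pointsE; rewrite rE; move: sA; rewrite Ds chain_map /mx_entries.
case: (chain r) => [[[a b] c] d]; rewrite !mxE.
by move=> [] /fmorph_inj -> /fmorph_inj -> /fmorph_inj -> /fmorph_inj ->.
Qed.

Lemma image_integral_point k (A : 'M[K]_2) (x : 'I_k -> K) :
    V_O_points O A x ->
  integral_point (image_pred f O) k (mx_entries (map_mx f A))
    [seq f (x i) | i <- enum 'I_k].
Proof.
move=> [/V_pointsE xA Ox]; split.
- by rewrite size_map size_enum_ord.
- apply/allP => _ /mapP[i _ ->]; apply/asboolP.
  by exists (x i); first exact: Ox.
by rewrite (map_comp f x) chain_map xA /mx_entries !mxE.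
Qed.

End Image.

(** Density holds in [F] for the image of [O] and for all polynomials over [F], in particular those
    coming from [K]. *)
Lemma Zariski_dense_of_point (K : fieldExtType rat) (F : closedFieldType)
    (f : {rmorphism K -> F}) (O : subringClosed K) (A : 'M[K]_2) k :
    infinite_set (units_of O) -> (exists x : 'I_k.+4 -> K, V_O_points O A x) ->
  Zariski_dense_V f O k.+4 A.
Proof.
move=> Uinf [x Ax] p p0 y /V_pointsE yA.
have evE (z : 'I_k.+4 -> F) (q : {mpoly F[k.+4]}) :
    q.@[fun i => [seq z j | j <- enum 'I_k.+4]`_i] = q.@[z].
  apply: meval_eq => i; rewrite (nth_map i) ?size_enum_ord //.
  by rewrite nth_ord_enum.
rewrite -evE.
apply: (zclosure_integral_points (congruence_units_image (f := f) Uinf) _ _ yA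
  (polyfun_meval (map_mpoly f p))).
- by exists [seq f (x i) | i <- enum 'I_k.+4]; apply: image_integral_point.
- by rewrite size_map size_enum_ord.
move=> s /integral_point_image[{}x {}Ax ->].
by rewrite evE (meval_map_mpoly f p x) p0 // rmorph0.
Qed.

(** * Padding by zeros and points over a field *)

Lemma chain_cat0 (R : nzRingType) (s : seq R) m :
  chain (s ++ nseq m 0) = chain s.
Proof.
elim: s => [|t s IHs] /=; last by rewrite IHs.
by elim: m => //= m ->; rewrite !mul0r !addr0.
Qed.

(** As [a] and [c] are not both 0, some [t] makes [c' = c - t * a] nonzero. With [d' = d - t * b],
    removing [L t] on the left leaves the product of [U ((a - 1) / c')], [L c'] and
    [U ((d' - 1) / c')]. *)
Lemma chain_SL2 (F : fieldType) (a b c d : F) : a * d - b * c = 1 ->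
  exists2 s : seq F, size s = 4 & chain s = (a, b, c, d).
Proof.
move=> det1; have [t nz] : exists t, c - t * a != 0.
  have [c0|nzc] := eqVneq c 0; last by exists 0; rewrite mul0r subr0.
  exists 1; rewrite c0 sub0r mul1r oppr_eq0.
  apply: contra_eq_neq det1 => ->.
  by rewrite c0 mul0r mulr0 subr0 eq_sym oner_eq0.
have d1 : a * d = 1 + b * c by rewrite -det1 subrK.
exists [:: t; (a - 1) / (c - t * a); c - t * a;
  (d - 1 - t * b) / (c - t * a)] => //=.
have -> : (a, b, c, d) = (a, (a * d - 1 - t * a * b) / (c - t * a), c,
    d - t * b + t * ((a * d - 1 - t * a * b) / (c - t * a))).
  have -> : (a * d - 1 - t * a * b) / (c - t * a) = b.
    by rewrite d1; field.
  by rewrite subrK.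
by congr (_, _, _, _); field.
Qed.

Lemma V_points_nth (R : comNzRingType) k (A : 'M[R]_2) (s : seq R) :
  size s = k -> V_points A (fun i : 'I_k => s`_i) <-> chain s = mx_entries A.
Proof.
by move=> szs; split=> [/V_pointsE|sA]; [|apply/V_pointsE];
  rewrite map_nth_enum_ord.
Qed.

Lemma V_points_nonempty (F : fieldType) (A : 'M[F]_2) k : \det A = 1 ->
  exists x : 'I_k.+4 -> F, V_points A x.
Proof.
have e1 : lift ord0 (ord0 : 'I_1) = ord_max by apply: val_inj.
have e2 : lift ord_max (ord0 : 'I_1) = ord0 by apply: val_inj.
rewrite (expand_det_row _ ord0) !big_ord_recl big_ord0 /cofactor !det_mx11 !mxE.
rewrite /= !(e1, e2) expr0 expr1 => det1.
have [|s szs sA] := @chain_SL2 F (A ord0 ord0) (A ord0 ord_max)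
  (A ord_max ord0) (A ord_max ord_max).
  by rewrite -det1; ring.
exists (fun i => (s ++ nseq k 0)`_i); apply/V_points_nth.
  by rewrite size_cat szs size_nseq.
by rewrite chain_cat0.
Qed.

Lemma V_O_points_widen (K : fieldExtType rat) (O : subringClosed K) k k'
    (A : 'M[K]_2) : (k <= k')%N ->
  (exists x : 'I_k -> K, V_O_points O A x) ->
  exists x : 'I_k' -> K, V_O_points O A x.
Proof.
move=> lekk' [x [/V_pointsE xA Ox]].
pose s := [seq x i | i <- enum 'I_k] ++ nseq (k' - k) 0.
exists (fun i => s`_i); split.
  apply/V_points_nth; last by rewrite chain_cat0.
  by rewrite size_cat size_map size_enum_ord size_nseq subnKC.
move=> i; have [/(mem_nth 0)|les] := ltnP i (size s); last first.
  by rewrite nth_default ?rpred0.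
rewrite mem_cat => /orP[/mapP[j _ ->] //|/nseqP[-> _]]; exact: rpred0.
Qed.

Theorem theorem4p3 (K : fieldExtType rat)
    (Kbar : closedFieldType) (iota : {rmorphism K -> Kbar})
    (iota_algebraic : integralRange iota)
    (S : set (prime_of K)) (S_finite : finite_set S)
    (S_archimedean : forall v : archimedean_prime K, S (Archimedean_prime v))
    (A : 'M[K]_2) (A_SL2 : in_SL2 (S_integers S) A)
    (units_infinite : infinite_set (units_of (S_integers S))) :
  (forall k : nat, (4 <= k)%N ->
     Zariski_dense_V iota (S_integers S) k A ->
     forall k' : nat, (k <= k')%N ->
       Zariski_dense_V iota (S_integers S) k' A)
  /\
  (forall k : nat, (4 <= k)%N ->
     (exists x : 'I_k -> K, V_O_points (S_integers S) A x) ->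
     Zariski_dense_V iota (S_integers S) k A).
Proof.
have part2 k : (4 <= k)%N ->
    (exists x : 'I_k -> K, V_O_points (S_integers S) A x) ->
    Zariski_dense_V iota (S_integers S) k A.
  by case: k => [|[|[|[|k]]]] // _; apply: Zariski_dense_of_point.
split=> // k k4 dense k' lekk'; apply: part2; first exact: leq_trans lekk'.
(* Without any [O]-point the constant 1 would vanish on all of them, and density would make it
   vanish at a point over [Kbar]. *)
apply: (V_O_points_widen lekk'); apply: contrapT => empty.
have [y Vy] : exists y : 'I_k -> Kbar, V_points (map_mx iota A) y.
  case: k k4 {dense lekk' empty} => [|[|[|[|k]]]] // _.
  by apply: V_points_nonempty; rewrite det_map_mx (proj2 A_SL2) rmorph1.
have /eqP : (map_mpoly iota 1).@[y] = 0.
  by apply: dense Vy => x Vx; case: empty; exists x.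
by rewrite rmorph1 meval1 oner_eq0.
Qed.
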